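(* Let $\theta(q,x)=\sum_{j=0}^{\infty}q^{j(j+1)/2}x^j$ and, for each integer $j\geq 1$, let $-\xi_j=-1/(q^j\Delta_j)$ be its $j$-th zero in $x$, where $\Delta_j=1+O(q)$ is a formal power series in $q$ (see the context). Write $-\xi_j$ as a Laurent series in $q$ in the form $-\xi_j=-q^{-j}+a_jq^{\kappa_j}+o(q^{\kappa_j})$, where $\kappa_j\in\mathbb{Z}$, $\kappa_j>-j$, and $a_jq^{\kappa_j}$ is the first nonzero term after $-q^{-j}$. Then: (1) For every $j\geq 1$, the series $\Delta_j$ is of the form $\Delta_j=1+(-1)^jq^{j(j+1)/2}\Phi_j(q)$, where $\Phi_j=1+O(q)$ is a formal power series in $q$. Hence $a_j=(-1)^j$ and $\kappa_j=j(j-1)/2$. (2) For every $j\geq 1$, represent the zero $-\xi_j$ in the form $$-\xi_j=-q^{-j}+(-1)^jq^{j(j-1)/2}\Big(1+\sum_{k=1}^{\infty}g_{j,k}q^k\Big).$$ There exists a formal power series $1+\sum_{k=1}^{\infty}r_kq^k$ with $r_k\in\mathbb{Z}$ such that $g_{j,k}=r_k$ for all $j\geq 2$ and all $k=1,\ldots,j$. Setting $r_k:=0$ for $k<0$ and $r_0:=1$, the coefficients $r_k$ satisfy, for all $k\geq 1$, the recurrence relation $$r_k=\sum_{\nu=1}^{\infty}(-1)^{\nu-1}(2\nu+1)\,r_{k-\nu(\nu+1)/2}.$$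
   Context: The partial theta function is the bivariate series $\theta(q,x)=\sum_{j=0}^{\infty}q^{j(j+1)/2}x^j$, $(q,x)\in\mathbb{C}^2$, $|q|<1$; for fixed $q$, $\theta(q,\cdot)$ is an entire function. It is known from earlier work that the zeros of $\theta(q,\cdot)$ can be presented in the form $-\xi_j=-1/(q^j\Delta_j)$, $j=1,2,\ldots$, where each $\Delta_j$ is a formal power series in $q$ of the form $1+O(q)$; that is, the formal Laurent series $-\xi_j=-q^{-j}/\Delta_j$ satisfies $\theta(q,-\xi_j)=0$ identically as a Laurent series in $q$. For $0<|q|\leq 0.108$ all these zeros are distinct, they depend analytically on $q$, and the series $\Delta_j$ converge. Here $O(q)$ denotes a power series in $q$ with zero constant term, and $o(q^{m})$ denotes a series containing only powers $q^n$ with $n>m$. The sum over $\nu$ in the recurrence has only finitely many nonzero terms, since $r_k=0$ for $k<0$. *)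

(* Defs.v *)
From HB Require Import structures.
From mathcomp Require Import all_boot all_order all_algebra.
From mathcomp Require Import all_classical all_reals.
From mathcomp Require Import complex.

Set Implicit Arguments.
Unset Strict Implicit.
Unset Printing Implicit Defensive.

Import Order.TTheory GRing.Theory Num.Theory.
Local Open Scope ring_scope.

Record fps (K : Type) := FPS { fps_coef :> nat -> K }.

HB.instance Definition _ (K : Type) := gen_eqMixin (fps K).
HB.instance Definition _ (K : Type) := gen_choiceMixin (fps K).

Lemma fpsP (K : Type) (f g : fps K) : f =1 g <-> f = g.
Proof.
by split=> [|-> //]; case: f g => [f] [g] /= /funext ->.
Qed.

Definition fps_zero (K : nmodType) : fps K := FPS (fun=> 0).
Definition fps_opp (K : zmodType) (f : fps K) : fps K := FPS (fun n => - f n).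
Definition fps_add (K : nmodType) (f g : fps K) : fps K :=
  FPS (fun n => f n + g n).
Definition fps_one (K : nzRingType) : fps K := FPS (fun n => (n == 0%N)%:R).
Definition fps_mul (K : nzRingType) (f g : fps K) : fps K :=
  FPS (fun n => \sum_(i < n.+1) f i * g (n - i)%N).
Definition fps_const (K : nmodType) (a : K) : fps K :=
  FPS (fun n => if n == 0%N then a else 0).
Definition fps_X (K : nzRingType) : fps K := FPS (fun n => (n == 1%N)%:R).

Lemma fps_addA (K : zmodType) : associative (@fps_add K).
Proof. by move=> f g h; apply/fpsP => n /=; rewrite addrA. Qed.

Lemma fps_addC (K : zmodType) : commutative (@fps_add K).
Proof. by move=> f g; apply/fpsP => n /=; rewrite addrC. Qed.

Lemma fps_add0 (K : zmodType) : left_id (fps_zero K) (@fps_add K).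
Proof. by move=> f; apply/fpsP => n /=; rewrite add0r. Qed.

Lemma fps_addN (K : zmodType) :
  left_inverse (fps_zero K) (@fps_opp K) (@fps_add K).
Proof. by move=> f; apply/fpsP => n /=; rewrite addNr. Qed.

HB.instance Definition _ (K : zmodType) := GRing.isZmodule.Build (fps K)
  (@fps_addA K) (@fps_addC K) (@fps_add0 K) (@fps_addN K).

Definition fps_trunc (K : nzRingType) (m : nat) (f : fps K) : {poly K} :=
  \poly_(i < m) f i.

Lemma fps_mul_trunc (K : nzRingType) (f g : fps K) (m n : nat) :
  (n < m)%N -> fps_mul f g n = (fps_trunc m f * fps_trunc m g)`_n.
Proof.
move=> nm; rewrite coefM /=; apply: eq_bigr => i _.
rewrite !coef_poly (leq_ltn_trans _ nm) ?(leq_ltn_trans _ nm) ?leq_subr //.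
by rewrite -ltnS.
Qed.

Lemma fps_mulC (K : comNzRingType) : commutative (@fps_mul K).
Proof.
by move=> f g; apply/fpsP => n; rewrite !(fps_mul_trunc _ _ (ltnSn n)) mulrC.
Qed.

Lemma fps_mulA (K : comNzRingType) : associative (@fps_mul K).
Proof.
move=> f g h; apply/fpsP => n.
have trM (u v : fps K) (p : {poly K}) :
    (fps_trunc n.+1 (fps_mul u v) * p)`_n =
    (fps_trunc n.+1 u * fps_trunc n.+1 v * p)`_n.
  rewrite !coefM; apply: eq_bigr => i _.
  by rewrite coef_poly ltn_ord (fps_mul_trunc _ _ (ltn_ord i)).
rewrite !(fps_mul_trunc _ _ (ltnSn n)).
by rewrite mulrC !trM mulrC mulrA.
Qed.

Lemma fps_mul1 (K : comNzRingType) : left_id (fps_one K) (@fps_mul K).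
Proof.
move=> f; apply/fpsP => n /=; rewrite big_ord_recl big1 ?addr0 ?subn0 ?mul1r //.
by move=> i _; rewrite mul0r.
Qed.

Lemma fps_mulDl (K : comNzRingType) :
  left_distributive (@fps_mul K) (@fps_add K).
Proof.
move=> f g h; apply/fpsP => n /=; rewrite -big_split /=.
by apply: eq_bigr => i _; rewrite mulrDl.
Qed.

Lemma fps_one_neq0 (K : comNzRingType) : fps_one K != fps_zero K.
Proof.
by apply/eqP => /(congr1 (fun f : fps K => f 0%N)) /eqP /=; rewrite oner_eq0.
Qed.

HB.instance Definition _ (K : comNzRingType) :=
  GRing.Zmodule_isComNzRing.Build (fps K)
    (@fps_mulA K) (@fps_mulC K) (@fps_mul1 K) (@fps_mulDl K) (@fps_one_neq0 K).

Definition fps_unit (K : comNzRingType) : pred (fps K) :=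
  fun f => `[< exists g : fps K, g * f = 1 >].
Definition fps_inv (K : comNzRingType) (f : fps K) : fps K :=
  if pselect (exists g : fps K, g * f = 1) is left e then projT1 (cid e) else f.

Lemma fps_mulVr (K : comNzRingType) :
  {in @fps_unit K, left_inverse 1 (@fps_inv K) *%R}.
Proof.
move=> f /asboolP fU; rewrite /fps_inv.
by case: pselect => // e; case: cid.
Qed.

Lemma fps_unitP (K : comNzRingType) (f g : fps K) : g * f = 1 -> fps_unit f.
Proof. by move=> gf; apply/asboolP; exists g. Qed.

Lemma fps_inv_out (K : comNzRingType) :
  {in [predC @fps_unit K], @fps_inv K =1 id}.
Proof.
move=> f /negP fU; rewrite /fps_inv; case: pselect => // e.
by case: fU; apply/asboolP.
Qed.

HB.instance Definition _ (K : comNzRingType) :=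
  GRing.ComNzRing_hasMulInverse.Build (fps K)
    (@fps_mulVr K) (@fps_unitP K) (@fps_inv_out K).

Lemma fps_neq0P (K : zmodType) (f : fps K) :
  f != 0 -> exists2 m, f m != 0 & forall i, (i < m)%N -> f i = 0.
Proof.
move=> f0; have ex : exists n, f n != 0.
  apply: contrapT => nex; case/negP: f0; apply/eqP/fpsP => n /=.
  by apply/eqP; apply: contrapT => /negP fn; apply: nex; exists n.
case: (ex_minnP ex) => m fm mmin; exists m => // i im.
by apply/eqP; apply: contraLR im => /mmin; rewrite -leqNgt.
Qed.

Lemma fps_idomain (K : idomainType) (f g : fps K) :
  f * g = 0 -> (f == 0) || (g == 0).
Proof.
move=> fg; apply: contraT; rewrite negb_or => /andP[].
move=> /fps_neq0P[m fm fmin] /fps_neq0P[n gn gmin].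
have /eqP : (f * g) (m + n)%N = 0 by rewrite fg.
rewrite /= (bigD1 (Ordinal (leq_addr n m : (m < (m + n).+1)%N))) //= addKn.
rewrite big1 ?addr0 ?mulf_eq0 ?(negPf fm) ?(negPf gn) // => i /eqP im.
have [lt_im|] := ltnP i m; first by rewrite fmin ?mul0r.
rewrite leq_eqVlt => /orP[/eqP mi|lt_mi].
  by case: im; apply: val_inj.
by rewrite gmin ?mulr0 // ltn_subLR ?ltn_add2r // -ltnS.
Qed.

HB.instance Definition _ (K : idomainType) :=
  GRing.ComUnitRing_isIntegral.Build (fps K) (@fps_idomain K).

(* K((q)), as the fraction field of K[[q]], for a field K. *)
Definition laurent (K : fieldType) : fieldType := {fraction (fps K)}.

Definition of_fps (K : fieldType) (f : fps K) : laurent K := tofrac f.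
Definition lq (K : fieldType) : laurent K := of_fps (fps_X K).

(* s contains only powers q^n with n > m. *)
Definition little_o (K : fieldType) (m : int) (s : laurent K) : Prop :=
  exists h : fps K, s = lq K ^ (m + 1) * of_fps h.

(* Convergence in the q-adic topology of K((q)). *)
Definition qadic_cvg (K : fieldType) (u : nat -> laurent K) (l : laurent K) :
    Prop :=
  forall m : int, exists N : nat, forall n : nat, (N <= n)%N ->
    little_o m (u n - l).

Definition theta_psum (F : comNzRingType) (q x : F) (n : nat) : F :=
  \sum_(j < n) q ^+ (j * j.+1)./2 * x ^+ j.

(* theta(q, x) = s identically as a Laurent series in q. *)
Definition theta_eq (K : fieldType) (x s : laurent K) : Prop :=
  qadic_cvg (theta_psum (lq K) x) s.

(* The series - xi_j = - q^(-j) / Delta_j. *)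
Definition minus_xi (K : fieldType) (j : nat) (Delta : fps K) : laurent K :=
  - lq K ^- j / of_fps Delta.

(* Delta is the series Delta_j of the j-th zero. By Hensel's lemma exactly one
   Delta qualifies: put x = - q^(-j) y in theta(q, x). Up to a power of q, the
   reduction modulo q is (-1)^(j-1) (y^(j-1) - y^j), which has y = 1 as a
   simple root. *)
Definition is_zero_series (K : fieldType) (j : nat) (Delta : fps K) : Prop :=
  Delta 0%N = 1 /\ theta_eq (minus_xi j Delta) 0.

(* z = - q^(-j) + a q^kappa + o(q^kappa), where a q^kappa is the first nonzero
   term after - q^(-j). *)
Definition first_term (K : fieldType) (j : nat) (z : laurent K)
    (a : K) (kappa : int) : Prop :=
  [/\ a != 0, - j%:Z < kappa &
      exists2 s, little_o kappa s &
        z = - lq K ^- j + of_fps (fps_const a) * lq K ^ kappa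
            + s].

(* The series sum_(k >= 1) c_k q^k. *)
Definition fps_tail (K : nmodType) (c : nat -> K) : fps K :=
  FPS (fun k => if (0 < k)%N then c k else 0).

(* Main.v *)
Require Import Defs.
From HB Require Import structures.
From mathcomp Require Import all_boot all_order all_algebra.
From mathcomp Require Import all_classical all_reals.
From mathcomp Require Import complex ring zify.

Set Implicit Arguments.
Unset Strict Implicit.
Unset Printing Implicit Defensive.

Import Order.TTheory GRing.Theory Num.Theory.
Local Open Scope classical_set_scope.
Local Open Scope ring_scope.

(** Put [x = - q^(-j) y] with [y = 1 / Delta_j], a power series with constant
    term [1], and write [T m = m(m+1)/2]. Multiplied by [q^(T (j-1))], the
    equation [theta(q, x) = 0] becomes, up to sign,
      [sum_(m >= -j) (-1)^m q^(T m) y^(j+m) = 0].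
    The exponent satisfies [T m = T (-1-m)], whereas the signs of the terms [m]
    and [-1-m] are opposite, so for [0 <= m < j] these two terms add up to
      [(-1)^m q^(T m) y^(j-1-m) (y^(2m+1) - 1)],
    a multiple of [y - 1]. Hence the equation reads [(y - 1) A + B = 0], where
      [A = sum_(m < j) (-1)^m q^(T m) y^(j-1-m) (1 + y + ... + y^(2m))]
    has constant term [1], and the unpaired terms [m >= j] add up to
      [B = (-1)^j q^(T j) (y^(2j) + O(q^(j+1)))]
    ([theta_pairing]). So
      [y = 1 - (-1)^j q^(T j) U]  with  [A U = y^(2j) + O(q^(j+1))]
    ([zero_expansion]). As [U] has constant term [1], this gives the form of
    [Delta_j = 1 / y] and the first two terms of [- xi_j = - q^(-j) y]; the
    series [1 + sum_k g_(j,k) q^k] is [U].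

    For [j >= 2] we have [T j >= j + 1], so [y = 1] modulo [q^(j+1)], and the
    last relation becomes [C U = 1] modulo [q^(j+1)] with
      [C = sum_(m >= 0) (-1)^m (2m+1) q^(T m)],
    which does not depend on [j] and has integer coefficients. Therefore [U]
    agrees up to [q^j] with [1 / C], whose coefficients are the [r_k]; the
    recurrence says that the coefficient of [q^k] in [C (1 / C)] is [0]
    ([r_coef_rec]). *)

(** * Triangular numbers *)

Definition tri (n : nat) : nat := (n * n.+1)./2.

Lemma triS n : tri n.+1 = (tri n + n.+1)%N.
Proof.
rewrite /tri; have -> : (n.+1 * n.+2 = n * n.+1 + n.+1.*2)%N by lia.
by rewrite addnC halfD odd_double add0n half_double addnC.
Qed.

Lemma tri_double n : (tri n + tri n = n * n.+1)%N.
Proof. by elim: n => // n IH; rewrite triS; lia. Qed.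

Lemma triD m n : tri (m + n) = (tri m + tri n + m * n)%N.
Proof.
elim: n => [|n IH]; first by rewrite muln0 !addn0.
by rewrite addnS !triS IH; lia.
Qed.

Lemma leq_tri n : (n <= tri n)%N.
Proof. by elim: n => // n IH; rewrite triS leq_addl. Qed.

Lemma leq_tri2 m n : (m <= n)%N -> (tri m <= tri n)%N.
Proof. by move=> /subnKC <-; rewrite triD -addnA leq_addr. Qed.

Lemma ltn_tri n : (2 <= n)%N -> (n < tri n)%N.
Proof. by case: n => [|[|n]] // _; rewrite !triS; lia. Qed.

(** The truncated differences make this one formula for the two branches of
    [(n - j)(n - j + 1) / 2], which is the triangular number of [n - j] when
    [j <= n] and of [j - 1 - n] when [n < j]. *)
Definition shifted_expo (j n : nat) : nat := tri ((n - j) + (j.-1 - n)).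

(** The left side is the exponent of [q] in the [n]-th term of
    [q^(j(j-1)/2) theta(q, x)]; the summand [j * n] is absorbed by the pole of
    [x^n] when [x = - q^(-j) y]. *)
Lemma shifted_expoE j n : (0 < j)%N ->
  (tri n + tri j.-1 = shifted_expo j n + j * n)%N.
Proof.
case: j => // j _; rewrite /shifted_expo succnK.
have [lenj|ltjn] := leqP n j.
  have -> : (n - j.+1 = 0)%N by lia.
  rewrite add0n -{1}(subnKC lenj) triD.
  by have := tri_double n; have := subnKC lenj; nia.
have -> : (j - n = 0)%N by lia.
rewrite addn0 -{1}(subnKC ltjn) triD triS.
by have := tri_double j; have := subnKC ltjn; nia.
Qed.

(** * Truncated equality of power series *)

Lemma fps_coefD (K : zmodType) (f g : fps K) n : (f + g) n = f n + g n.
Proof. by []. Qed.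

Lemma fps_coefB (K : zmodType) (f g : fps K) n : (f - g) n = f n - g n.
Proof. by []. Qed.

Lemma fps_coef1 (K : comNzRingType) n : (1 : fps K) n = (n == 0%N)%:R.
Proof. by []. Qed.

Lemma fps_coefM (K : comNzRingType) (f g : fps K) n :
  (f * g) n = \sum_(i < n.+1) f i * g (n - i)%N.
Proof. by []. Qed.

Lemma fps_coef0M (K : comNzRingType) (f g : fps K) :
  (f * g) 0%N = f 0%N * g 0%N.
Proof. by rewrite fps_coefM big_ord1. Qed.

Lemma fps_coef0X (K : comNzRingType) (f : fps K) k : (f ^+ k) 0%N = f 0%N ^+ k.
Proof. by elim: k => // k IH; rewrite !exprS fps_coef0M IH. Qed.

Lemma fps_coef_sum (K : zmodType) I (s : seq I) (P : pred I)
    (F : I -> fps K) n :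
  (\sum_(i <- s | P i) F i) n = \sum_(i <- s | P i) F i n.
Proof. exact: (big_morph (fun f : fps K => f n)). Qed.

Lemma fps_coefXM (K : comNzRingType) (f : fps K) k n :
  (fps_X K ^+ k * f) n = if (n < k)%N then 0 else f (n - k)%N.
Proof.
have X1 (g : fps K) m : (fps_X K * g) m = if m is m'.+1 then g m' else 0.
  rewrite fps_coefM big_ord_recl /= mul0r add0r.
  case: m => [|m]; first by rewrite big_ord0.
  rewrite big_ord_recl big1 => [|i _]; last by rewrite /= /bump !add1n mul0r.
  by rewrite mul1r addr0 /= subSS subn0.
elim: k n => [|k IH] n; first by rewrite mul1r subn0.
by rewrite exprS -mulrA X1; case: n => [|n] //; rewrite IH ltnS subSS.
Qed.

Definition eqmodX (K : Type) (M : nat) (f g : fps K) :=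
  forall n, (n < M)%N -> f n = g n.

Lemma eqmodX_sym (K : Type) M (f g : fps K) : eqmodX M f g -> eqmodX M g f.
Proof. by move=> fg n /fg. Qed.

Lemma eqmodX_trans (K : Type) M (f g h : fps K) :
  eqmodX M f g -> eqmodX M g h -> eqmodX M f h.
Proof. by move=> fg gh n nM; rewrite fg // gh. Qed.

Lemma eqmodXM (K : comNzRingType) M (f g f' g' : fps K) :
  eqmodX M f g -> eqmodX M f' g' -> eqmodX M (f * f') (g * g').
Proof.
move=> fg fg' n nM; rewrite !fps_coefM; apply: eq_bigr => i _.
by rewrite fg ?fg' // (leq_ltn_trans _ nM) ?leq_subr // -ltnS.
Qed.

Lemma eqmodX_exp (K : comNzRingType) M (f g : fps K) k :
  eqmodX M f g -> eqmodX M (f ^+ k) (g ^+ k).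
Proof. by move=> fg; elim: k => // k IH; rewrite !exprS; apply: eqmodXM. Qed.

Lemma eqmodX_sum (K : zmodType) M I (s : seq I) (P : pred I)
    (F G : I -> fps K) :
  (forall i, P i -> eqmodX M (F i) (G i)) ->
  eqmodX M (\sum_(i <- s | P i) F i) (\sum_(i <- s | P i) G i).
Proof.
by move=> FG n nM; rewrite !fps_coef_sum; apply: eq_bigr => i Pi; apply: FG.
Qed.

Lemma eqmodX_Xn0 (K : comNzRingType) M k (f : fps K) :
  (M <= k)%N -> eqmodX M (fps_X K ^+ k * f) 0.
Proof. by move=> Mk n nM; rewrite fps_coefXM (leq_trans nM Mk). Qed.

Lemma eqmodX0P (K : comNzRingType) M (f : fps K) :
  eqmodX M f 0 -> exists h, f = fps_X K ^+ M * h.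
Proof.
move=> f0; exists (FPS (fun n => f (M + n)%N)); apply/fpsP => n.
rewrite fps_coefXM; case: ltnP => [/f0 //|Mn].
by rewrite /= subnKC.
Qed.

(** With [u = 1 - f], which has no constant term, the geometric series
    [1 + u + u^2 + ...] inverts [f]; its coefficient of [q^n] is that of any
    partial sum with more than [n] terms. *)
Lemma fps_unit1 (K : comNzRingType) (f : fps K) :
  f 0%N = 1 -> f \is a GRing.unit.
Proof.
move=> f0; pose u := 1 - f; pose S n := \sum_(k < n) u ^+ k.
have uk k : eqmodX k (u ^+ k) 0.
  have /eqmodX0P[h uh] : eqmodX 1 u 0.
    by case=> // _; rewrite /u fps_coefB fps_coef1 f0 subrr.
  by rewrite uh exprMn -exprM mul1n; apply: eqmodX_Xn0.
have fS n : f * S n = 1 - u ^+ n.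
  have -> : f = 1 - u by rewrite /u opprB addrC subrK.
  by rewrite -opprB mulNr -subrX1 opprB.
apply/unitrPr; exists (FPS (fun n => S n.+1 n)).
have Sn n : eqmodX n.+1 (FPS (fun n => S n.+1 n)) (S n.+1).
  move=> k kn; change (S k.+1 k = S n.+1 k).
  rewrite /S -(subnKC kn) big_split_ord fps_coefD.
  rewrite [X in _ + X]fps_coef_sum [X in _ + X]big1 ?addr0 // => i _.
  by apply: uk; apply: leq_addr.
apply/fpsP => n.
have -> := @eqmodXM K n.+1 f f _ _ (fun _ _ => erefl) (Sn n) n (ltnSn n).
by rewrite fS fps_coefB (uk n.+1 n) // subr0.
Qed.

(** * The equation of a zero *)

(** The terms [m] and [-1 - m] of the bilateral series
    [sum_m (-1)^m q^(m(m+1)/2) y^(j+m)] have the same exponent of [q] and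
    opposite signs, so together they contribute a multiple of [y - 1]. This is
    the sum of the quotients by [y - 1] over the [j] pairs. *)
Definition paired_quotient (K : comNzRingType) (j : nat) (y : fps K) : fps K :=
  \sum_(m < j) (-1) ^+ m * fps_X K ^+ tri m * y ^+ (j.-1 - m)
               * \sum_(i < m.*2.+1) y ^+ i.

Definition unpaired_tail (K : comNzRingType) (j L : nat) (y : fps K) : fps K :=
  \sum_(l < L) (-1) ^+ l * fps_X K ^+ (j * l + tri l) * y ^+ (j.*2 + l).

(** The terms [n = j - 1 - m] and [n = j + m], for [m < j], are the two members
    of a pair; the terms [n >= 2j] have no partner. *)
Lemma theta_pairing (K : comNzRingType) (j L : nat) (y : fps K) : (0 < j)%N ->
  \sum_(n < j.*2 + L) (-1) ^+ n * fps_X K ^+ shifted_expo j n * y ^+ n =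
  (-1) ^+ j * (y - 1) * paired_quotient j y
  + fps_X K ^+ tri j * unpaired_tail j L y.
Proof.
move=> j0; rewrite -addnn !big_split_ord /=; congr (_ + _); last first.
  rewrite mulr_sumr; apply: eq_bigr => l _.
  rewrite addnn -signr_odd oddD odd_double addFb signr_odd /shifted_expo.
  have -> : (j.*2 + l - j + (j.-1 - (j.*2 + l)) = j + l)%N by lia.
  by rewrite triD !exprD; ring.
rewrite (reindex_inj rev_ord_inj) /= -big_split /= mulr_sumr.
apply: eq_bigr => -[m mj] _ /=.
have -> : shifted_expo j (j - m.+1) = tri m.
  by rewrite /shifted_expo; congr tri; lia.
have -> : shifted_expo j (j + m) = tri m.
  by rewrite /shifted_expo; congr tri; lia.
have -> : (j - m.+1 = j.-1 - m)%N by lia.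
have -> : (-1) ^+ (j.-1 - m) = - ((-1) ^+ j * (-1) ^+ m) :> fps K.
  rewrite -exprD -(mulN1r (_ ^+ _)) -exprS -signr_odd -[RHS]signr_odd.
  by congr (_ ^+ nat_of_bool _); lia.
have -> : y ^+ (j + m) = y ^+ (j.-1 - m) * y ^+ m.*2.+1.
  by rewrite -exprD; congr (_ ^+ _); lia.
have := subrX1 y m.*2.+1; rewrite exprD => yX.
transitivity ((-1) ^+ j * (-1) ^+ m * fps_X K ^+ tri m * y ^+ (j.-1 - m) *
   (y ^+ m.*2.+1 - 1)); first by ring.
by rewrite yX; ring.
Qed.

(** The second term of the tail already carries
    [q^(T (j+1) - T j) = q^(j+1)]. *)
Lemma unpaired_tail_lead (K : comNzRingType) (j L : nat) (y : fps K) :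
  eqmodX j.+1 (unpaired_tail j L.+1 y) (y ^+ j.*2).
Proof.
move=> n nj; rewrite /unpaired_tail big_ord_recl fps_coefD.
rewrite [X in _ + X]fps_coef_sum [X in _ + X]big1 => [|l _].
  by rewrite addr0 muln0 !addn0 expr0 mul1r mul1r.
rewrite mulrAC mulrC; apply: eqmodX_Xn0 nj.
by rewrite !lift0 triS; nia.
Qed.

Lemma paired_quotient_coef0 (K : comNzRingType) (j : nat) (y : fps K) :
  (0 < j)%N -> y 0%N = 1 -> paired_quotient j y 0%N = 1.
Proof.
case: j => // j _ y0; rewrite fps_coef_sum big_ord_recl.
rewrite [X in _ + X]big1 => [|m _].
  rewrite addr0 !fps_coef0M -[X in _ * X]/((\sum_(i < 1) y ^+ i) 0%N) big_ord1.
  by rewrite mulr1 !mul1r subn0 fps_coef0X y0 expr1n.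
rewrite -mulrA mulrAC mulrC; apply: (@eqmodX_Xn0 _ 1) => //.
Qed.

(** Solving [(y - 1) A + B = 0] for [y - 1]. One partial sum is enough: a sum
    that vanishes modulo [q^(T j + j + 1)] leaves, after division by [q^(T j)],
    an error of order [q^(j+1)], and that is the precision claimed for [U]. *)
Lemma zero_expansion (K : idomainType) (j : nat) (y : fps K) :
  (0 < j)%N -> y 0%N = 1 ->
  (forall M, exists N, forall n, (N <= n)%N ->
     eqmodX M
       (\sum_(i < n) (-1) ^+ i * fps_X K ^+ shifted_expo j i * y ^+ i) 0) ->
  exists2 U : fps K, y = 1 - (-1) ^+ j * fps_X K ^+ tri j * U &
    eqmodX j.+1 (paired_quotient j y * U) (y ^+ j.*2).
Proof.
(* With [j.*2 + N.+1] terms, the tail contains its leading term [y^(2j)]. *)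
move=> j0 y0 /(_ (tri j + j.+1)%N)[N /(_ (j.*2 + N.+1)%N)].
rewrite theta_pairing // => /(_ ltac:(lia))/eqmodX0P[h].
have Au := fps_unit1 (paired_quotient_coef0 j0 y0).
set A := paired_quotient j y in Au *; set B := unpaired_tail _ _ _ => eqn.
exists (A^-1 * (B - fps_X K ^+ j.+1 * h)); last first.
  rewrite mulVKr // -[X in eqmodX _ _ X]subr0.
  move=> n nj; rewrite !fps_coefB (unpaired_tail_lead _ _ nj).
  by rewrite (eqmodX_Xn0 _ (leqnn _) nj).
apply: (mulrI Au); rewrite mulrBr mulr1 [in RHS](mulrCA A) mulVKr //.
set s := (-1) ^+ j in eqn *; have ss : s * s = 1 by rewrite -expr2 sqrr_sign.
have -> : s * fps_X K ^+ tri j * (B - fps_X K ^+ j.+1 * h)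
        = (s * s) * ((1 - y) * A).
  transitivity (s * (fps_X K ^+ tri j * B - fps_X K ^+ (tri j + j.+1) * h)).
    by rewrite exprD; ring.
  by rewrite -eqn; ring.
by rewrite ss; ring.
Qed.

(** * The series of the coefficients r_k *)

Lemma fps_const_is_zmod_morphism (K : comNzRingType) :
  zmod_morphism (@fps_const K).
Proof.
move=> a b; apply/fpsP => n; rewrite fps_coefB.
by case: n => //= n; rewrite subr0.
Qed.

Lemma fps_const_is_monoid_morphism (K : comNzRingType) :
  monoid_morphism (@fps_const K).
Proof.
split=> [|a b]; first by apply/fpsP => -[].
apply/fpsP => n; rewrite fps_coefM big_ord_recl big1 => [|i _]; last first.
  by rewrite /= mul0r.
by rewrite addr0 subn0 /=; case: n => //=; rewrite mulr0.
Qed.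

HB.instance Definition _ (K : comNzRingType) :=
  GRing.isZmodMorphism.Build K (fps K) (@fps_const K)
    (@fps_const_is_zmod_morphism K).
HB.instance Definition _ (K : comNzRingType) :=
  GRing.isMonoidMorphism.Build K (fps K) (@fps_const K)
    (@fps_const_is_monoid_morphism K).

Lemma fps_coef_constM (K : comNzRingType) (a : K) (f : fps K) n :
  (fps_const a * f) n = a * f n.
Proof.
rewrite fps_coefM big_ord_recl big1 => [|i _]; last by rewrite /= mul0r.
by rewrite addr0 subn0.
Qed.

(** The value at [y = 1] of [(-1)^m (1 + y + ... + y^(2m))]. *)
Definition cube_coef (K : nzRingType) (m : nat) : K := (-1) ^+ m * m.*2.+1%:R.

(** By Jacobi's identity this is [prod_(i >= 1) (1 - q^i)^3]. *)
Definition cube_series (K : nzRingType) : fps K :=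
  FPS (fun n => \sum_(m < n.+1 | tri m == n) cube_coef K m).

Lemma cube_series_trunc (K : comNzRingType) M N : (M <= tri N)%N ->
  eqmodX M (cube_series K)
    (\sum_(m < N) fps_const (cube_coef K m) * fps_X K ^+ tri m).
Proof.
move=> MN k kM; rewrite fps_coef_sum.
have E m : (fps_const (cube_coef K m) * fps_X K ^+ tri m) k =
           if tri m == k then cube_coef K m else 0.
  rewrite fps_coef_constM -[_ ^+ _]mulr1 fps_coefXM fps_coef1.
  case: ltngtP => [_|kt|->]; rewrite ?mulr0 //; last by rewrite subnn mulr1.
  by rewrite subn_eq0 leqNgt kt mulr0.
under [RHS]eq_bigr do rewrite E.
rewrite [LHS]/= big_mkcond.
(* An [m] with [tri m = k] lies below both bounds of summation. *)
pose F m := if tri m == k then cube_coef K m else 0.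
have W n : (forall m, tri m = k -> (m < n)%N) ->
    \sum_(m < n) F m = \sum_(m < k.+1 + N) F m.
  move=> tk.
  rewrite -!(big_mkord xpredT F).
  have [le|lt] := leqP n (k.+1 + N).
    rewrite [RHS](big_cat_nat (n := n)) //= [X in _ + X]big_nat.
    rewrite [X in _ + X]big1 ?addr0 //.
    by move=> i /andP[ni _]; rewrite /F; case: eqP => // /tk; rewrite ltnNge ni.
  rewrite [LHS](big_cat_nat (n := (k.+1 + N)%N)) //= 1?ltnW //.
  rewrite [X in _ + X]big_nat [X in _ + X]big1 ?addr0 // => i /andP[ni _].
  rewrite /F; case: eqP => // ti; have := leq_tri i; lia.
rewrite (W k.+1) ?(W N) // => m tm; last by rewrite ltnS -tm leq_tri.
rewrite ltnNge; apply: contraL kM => /leq_tri2.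
by rewrite tm -leqNgt => /(leq_trans MN).
Qed.

Lemma paired_quotient_mod (K : comNzRingType) (j M : nat) (y : fps K) :
  (M <= tri j)%N -> eqmodX M y 1 ->
  eqmodX M (paired_quotient j y) (cube_series K).
Proof.
move=> Mj y1; apply: (eqmodX_trans _ (eqmodX_sym (cube_series_trunc _ Mj))).
apply: eqmodX_sum => m _.
(* This is the summand of [paired_quotient] at [y = 1]. *)
have -> : fps_const (cube_coef K m) * fps_X K ^+ tri m =
   (-1) ^+ m * fps_X K ^+ tri m * 1 ^+ (j.-1 - m) * \sum_(i < m.*2.+1) 1 ^+ i.
  under eq_bigr do rewrite expr1n.
  rewrite sumr_const card_ord expr1n mulr1 /cube_coef.
  by rewrite rmorphM rmorph_sign rmorph_nat mulrAC.
apply: eqmodXM; first by apply: eqmodXM => //; apply: eqmodX_exp.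
by apply: eqmodX_sum => i _; apply: eqmodX_exp.
Qed.

Lemma cube_series_unit (K : comNzRingType) : cube_series K \is a GRing.unit.
Proof.
by apply: fps_unit1; rewrite /= big_mkcond big_ord1 /= /cube_coef mul1r.
Qed.

Lemma cube_series_mul (K : comNzRingType) (f : fps K) k :
  (cube_series K * f) k =
  \sum_(m < k.+1)
    cube_coef K m * (if (k < tri m)%N then 0 else f (k - tri m)%N).
Proof.
have Tr := @cube_series_trunc K k.+1 k.+1 (leq_tri k.+1).
rewrite (eqmodXM Tr (fun _ _ => erefl (f _)) (ltnSn k)) mulr_suml fps_coef_sum.
by apply: eq_bigr => m _; rewrite -mulrA fps_coef_constM fps_coefXM.
Qed.

Definition r_series : fps int := (cube_series int)^-1.

Definition r_coef (z : int) : int := if z is Posz n then r_series n else 0.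

Lemma r_coef0 : r_coef 0 = 1.
Proof.
have := mulrV (cube_series_unit int) => /(congr1 (fun f : fps int => f 0%N)).
rewrite cube_series_mul big_ord1 /= => /[!subnn].
by rewrite /cube_coef expr0 !mul1r.
Qed.

Lemma r_coefB k t :
  r_coef (k%:Z - t%:Z) = if (k < t)%N then 0 else r_series (k - t)%N.
Proof.
case: ltnP => [kt|tk]; last by rewrite subzn.
by rewrite -opprB subzn 1?ltnW // -(subnSK kt) -NegzE.
Qed.

Lemma r_coef_rec k : (1 <= k)%N ->
  r_coef k%:Z =
    \sum_(nu \in [set n : nat | (1 <= n)%N])
      (-1) ^+ (nu - 1) * (2 * nu%:Z + 1) * r_coef (k%:Z - (nu * nu.+1)./2%:Z).
Proof.
move=> k0; pose F m := cube_coef int m * r_coef (k%:Z - (tri m)%:Z).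
have : \sum_(m < k.+1) F m = 0.
  have := mulrV (cube_series_unit int) => /(congr1 (fun f : fps int => f k)).
  rewrite cube_series_mul fps_coef1 eqn0Ngt k0 /= => E; rewrite -[RHS]E.
  by apply: eq_bigr => m _; rewrite /F r_coefB.
rewrite -(big_mkord xpredT F) big_ltn // {1}/F /cube_coef !mul1r subr0.
move=> /eqP; rewrite addr_eq0 => /eqP ->.
(* The terms with [nu > k] vanish because [nu(nu+1)/2 >= nu]. *)
rewrite (fsbigE (index_iota 1 k.+1)) ?iota_uniq //; first last.
- move=> i /= i1; rewrite mem_index_iota i1 /= -leqNgt => ki.
  rewrite -/(tri i) r_coefB (leq_trans _ (leq_tri i)) ?mulr0 //.
- by move=> i /=; rewrite mem_index_iota => /andP[].
rewrite -sumrN big_nat [RHS]big_nat_cond; apply: eq_big => [i|i /andP[i1 _]].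
  by case: (ltnP 0 i) => //= i1; rewrite [i \in _]mem_set ?andbT.
rewrite /F /cube_coef -/(tri i) -!mulNr; congr (_ * _ * _).
  by case: i i1 => // i _; rewrite exprS mulN1r opprK subn1.
by rewrite -natz; lia.
Qed.

Lemma r_series_map (K : comNzRingType) :
  cube_series K * FPS (fun n => (r_series n)%:~R) = 1.
Proof.
apply/fpsP => k; rewrite cube_series_mul fps_coef1.
transitivity (((cube_series int * r_series) k)%:~R : K); last first.
  by rewrite /r_series mulrV ?cube_series_unit // fps_coef1 rmorph_nat.
rewrite cube_series_mul rmorph_sum; apply: eq_bigr => m _ /=.
rewrite rmorphM /cube_coef rmorphM rmorph_sign rmorph_nat.
by case: ifP => //=.
Qed.

(** * Leading terms of Laurent series *)

HB.instance Definition _ (K : fieldType) :=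
  GRing.RMorphism.copy (@of_fps K) (@FracField.tofrac (fps K)).

Lemma of_fps_inj (K : fieldType) : injective (@of_fps K).
Proof. by move=> f g /eqP; rewrite tofrac_eq => /eqP. Qed.

Lemma lq_neq0 (K : fieldType) : lq K != 0.
Proof.
rewrite tofrac_eq0; apply/eqP => /(congr1 (fun f : fps K => f 1%N)) /eqP.
by rewrite /= oner_eq0.
Qed.

Lemma lqX_of_fps (K : fieldType) n : lq K ^+ n = of_fps (fps_X K ^+ n).
Proof. by rewrite rmorphXn. Qed.

(** If [a <= b], then cancelling [q^a] leaves [f = q^(b-a) g], and a nonzero
    constant term of [f] forces [b = a]. *)
Lemma leading_term_uniq (K : fieldType) (f g : fps K) (a b : int) :
  f 0%N != 0 -> g 0%N != 0 -> lq K ^ a * of_fps f = lq K ^ b * of_fps g ->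
  a = b /\ f 0%N = g 0%N.
Proof.
wlog ab : f g a b / a <= b => [W f0 g0 E|f0 g0].
  by case: (leP a b) => [/W|/ltW/W H]; [apply|have [] := H g f g0 f0 (esym E)].
have ba : `|b - a|%N%:Z = b - a by rewrite gez0_abs // subr_ge0.
have -> : b = a + `|b - a|%N%:Z by rewrite ba; ring.
rewrite expfzDr ?lq_neq0 // -mulrA.
move=> /(mulfI (expfz_neq0 _ (lq_neq0 K))).
rewrite -exprnP lqX_of_fps -rmorphM => /of_fps_inj fg.
move: f0; rewrite fg fps_coefXM.
by case: `|b - a|%N => [|n]; rewrite ?eqxx //= addr0.
Qed.

Lemma first_termP (K : fieldType) j (z : laurent K) (s : K) (t : nat)
    (U : fps K) :
  (0 < j)%N -> s != 0 -> U 0%N = 1 ->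
  z = - lq K ^- j + of_fps (fps_const s) * lq K ^+ t * of_fps U ->
  forall a kappa, first_term j z a kappa <-> a = s /\ kappa = t%:Z.
Proof.
move=> j0 s0 U0 -> a kappa; split=> [[a0 _ [_ [h ->]]]|[-> ->]].
  rewrite -addrA => /addrI.
  rewrite expfzDr ?lq_neq0 // expr1z.
  rewrite [of_fps _ * _ ^+ _]mulrC [of_fps _ * _ ^ _]mulrC.
  rewrite -!mulrA -mulrDr -!rmorphM -rmorphD exprnP => /esym/leading_term_uniq.
  rewrite fps_coefD -[fps_X K]expr1 fps_coefXM fps_coef_constM U0 mulr1 addr0.
  by move=> /(_ a0 s0)[-> /= ->].
split=> //; first by lia.
have /eqmodX0P[h Uh] : eqmodX 1 (U - 1) 0.
  by case=> // _; rewrite fps_coefB U0 subrr.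
exists (of_fps (fps_const s) * lq K ^+ t * of_fps (U - 1)).
  exists (fps_const s * h); rewrite Uh expfzDr ?lq_neq0 // expr1z !rmorphM /=.
  by rewrite -exprnP; ring.
by rewrite rmorphB rmorph1 /= -exprnP; ring.
Qed.

(** * The zeros of the partial theta function *)

Lemma theta_psum_shift (K : fieldType) (j n : nat) (y : fps K) : (0 < j)%N ->
  lq K ^+ tri j.-1 * theta_psum (lq K) (- lq K ^- j * of_fps y) n =
  of_fps (\sum_(i < n) (-1) ^+ i * fps_X K ^+ shifted_expo j i * y ^+ i).
Proof.
move=> j0; rewrite mulr_sumr rmorph_sum; apply: eq_bigr => i _ /=.
rewrite !rmorphM !rmorphXn rmorphN1 -/(lq K) -/(tri i) mulrA -exprD.
rewrite addnC shifted_expoE // exprD exprMn exprNn exprVn -exprM.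
have q0 : lq K ^+ (j * i) != 0 by rewrite expf_neq0 ?lq_neq0.
by rewrite -!mulrA (mulrCA (lq K ^+ (j * i))) mulVKf // mulrCA.
Qed.

(** The last clause is where [j >= 2] enters: it gives [j < T j], so the
    correction [q^(T j) U] is invisible modulo [q^(j+1)] and [y] may be replaced
    by [1]. *)
Lemma minus_xi_expansion (K : fieldType) (j : nat) (Delta : fps K) :
  (0 < j)%N -> is_zero_series j Delta ->
  exists U : fps K,
    [/\ U 0%N = 1,
        Delta = 1 + (-1) ^+ j * fps_X K ^+ tri j * (Delta * U),
        minus_xi j Delta
          = - lq K ^- j + (-1) ^+ j * lq K ^+ tri j.-1 * of_fps U &
        (2 <= j)%N ->
          eqmodX j.+1 U (FPS (fun n => (r_series n)%:~R))].
Proof.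
move=> j0 [D0 DE]; have Du := fps_unit1 D0.
pose y := Delta^-1; have Dy : Delta * y = 1 by rewrite mulrV.
have y0 : y 0%N = 1.
  by have := congr1 (fun f : fps K => f 0%N) Dy; rewrite fps_coef0M D0 mul1r.
have xiE : minus_xi j Delta = - lq K ^- j * of_fps y.
  by rewrite /minus_xi /y rmorphV.
have [|U yU AU] := zero_expansion j0 y0.
  move=> M; have [N HN] := DE M%:Z; exists N => n /HN[h].
  rewrite subr0 xiE => /(congr1 ( *%R (lq K ^+ tri j.-1))).
  rewrite theta_psum_shift // -[_ + 1]/((M + 1)%N%:Z) -exprnP mulrA -exprD.
  rewrite lqX_of_fps -rmorphM => /of_fps_inj ->.
  by apply: eqmodX_Xn0; lia.
have U0 : U 0%N = 1.
  have := AU 0%N isT; rewrite fps_coef0M paired_quotient_coef0 // mul1r => ->.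
  by rewrite fps_coef0X y0 expr1n.
exists U; split=> //.
- by rewrite -[X in _ = X + _]Dy [in RHS]yU; ring.
- rewrite xiE yU rmorphB rmorph1 !rmorphM rmorph_sign rmorphXn /= -/(lq K).
  have -> : tri j = (tri j.-1 + j)%N by rewrite -{1}(prednK j0) triS prednK.
  rewrite exprD.
  have q0 : lq K ^+ j != 0 by rewrite expf_neq0 ?lq_neq0.
  rewrite mulrBr mulr1 mulNr opprK; congr (_ + _).
  rewrite -!mulrA mulrCA; congr (_ * _).
  by rewrite mulrCA mulKf.
move=> j2; have y1 : eqmodX j.+1 y 1.
  rewrite yU => n nj; rewrite fps_coefB [X in _ - X](_ : _ = 0) ?subr0 //.
  by rewrite mulrAC mulrC; apply: eqmodX_Xn0 nj; apply: ltn_tri.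
have CU : eqmodX j.+1 (cube_series K * U) 1.
  have A1 := paired_quotient_mod (ltn_tri j2) y1.
  apply: eqmodX_trans (eqmodXM (eqmodX_sym A1) (fun _ _ => erefl (U _))) _.
  apply: eqmodX_trans AU _.
  by rewrite -[X in eqmodX _ _ X](expr1n _ j.*2); apply: eqmodX_exp.
(* [U = (C R) U = R (C U) = R], where [R] is the inverse of [C]. *)
rewrite -[U]mul1r -(r_series_map K) -mulrA mulrCA.
rewrite -[X in eqmodX _ _ X]mulr1; exact: eqmodXM.
Qed.

Theorem theorem1 (R : realType) (Delta : nat -> fps R[i])
    (hDelta : forall j : nat, (1 <= j)%N -> is_zero_series j (Delta j)) :
  (forall j : nat, (1 <= j)%N ->
     (exists2 Phi : fps R[i], Phi 0%N = 1 &
        Delta j = 1 + (-1) ^+ j * fps_X R[i] ^+ (j * j.+1)./2 * Phi) /\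
     (forall (a : R[i]) (kappa : int),
        first_term j (minus_xi j (Delta j)) a kappa <->
        a = (-1) ^+ j /\ kappa = (j * j.-1)./2%:Z))
  /\
  (exists g : nat -> nat -> R[i],
     (forall j : nat, (1 <= j)%N ->
        minus_xi j (Delta j) =
          - lq R[i] ^- j
          + (-1) ^+ j * lq R[i] ^+ (j * j.-1)./2
            * (1 + of_fps (fps_tail (g j)))) /\
     (exists r : int -> int,
        [/\ forall k : int, k < 0 -> r k = 0,
            r 0 = 1,
            forall j k : nat, (2 <= j)%N -> (1 <= k <= j)%N ->
              g j k = (r k%:Z)%:~R &
            forall k : nat, (1 <= k)%N ->
              r k%:Z =
                \sum_(nu \in [set n : nat | (1 <= n)%N])
                  (-1) ^+ (nu - 1) * (2 * nu%:Z + 1)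
                  * r (k%:Z - (nu * nu.+1)./2%:Z)])).
Proof.
have triP j : (0 < j)%N -> ((j * j.-1)./2 = tri j.-1)%N.
  by move=> j0; rewrite /tri prednK // mulnC.
have /choice[U HU] j : exists Uj : fps R[i], (1 <= j)%N ->
    [/\ Uj 0%N = 1,
        Delta j = 1 + (-1) ^+ j * fps_X R[i] ^+ tri j * (Delta j * Uj),
        minus_xi j (Delta j)
          = - lq R[i] ^- j + (-1) ^+ j * lq R[i] ^+ tri j.-1 * of_fps Uj &
        (2 <= j)%N -> eqmodX j.+1 Uj (FPS (fun n => (r_series n)%:~R))].
  have [->|j0] := posnP j; first by exists 0.
  by have [Uj HUj] := minus_xi_expansion j0 (hDelta j j0); exists Uj.
split=> [j j0|].
  have [U0 DU xiU _] := HU j j0; split.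
    exists (Delta j * U j) => //.
    by rewrite fps_coef0M U0 mulr1; case: (hDelta j j0).
  rewrite triP //; apply: (@first_termP _ _ _ _ _ (U j)) => //.
    by rewrite signr_eq0.
  by rewrite rmorph_sign rmorph_sign.
exists (fun j => U j); split=> [j j0|].
  have [U0 _ -> _] := HU j j0; rewrite triP //.
  congr (_ + _ * _); rewrite -(rmorph1 (@of_fps R[i])) -rmorphD; congr of_fps.
  by apply/fpsP => -[|n]; rewrite fps_coefD /= ?addr0 ?add0r.
exists r_coef; split=> [[]//||j k j2 /andP[_ kj]|].
- exact: r_coef0.
- by have [_ _ _ /(_ j2) ->] := HU j (ltnW j2).
- exact: r_coef_rec.
Qed.
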